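(* Let $R$ be a maximal subring of a ring $T$. Then at least one of the following holds: (1) There exists a (minimal) prime ideal $Q$ of $T$ such that $Q\subseteq (R:T)$. In particular, $Nil_*(T)\subseteq Q\subseteq (R:T)$. (2) $Nil_*(R)\subseteq Nil_*(T)\cap R\subseteq Nil^*(R)$. In particular, if there exists a nonzero ideal $I$ of $T$ such that $R\cap I=0$, then $Nil_*(R)=Nil_*(T)\cap R$.
   Context: All rings are associative and unital (not necessarily commutative), and subrings contain the identity of the big ring; ''ideal'' means two-sided ideal. A maximal subring $R$ of $T$ is a proper subring with no subring strictly between $R$ and $T$. $(R:T)=\{x\in T: TxT\subseteq R\}$ is the largest ideal of $T$ contained in $R$. $Nil_*$ denotes the lower nilradical (the intersection of all prime ideals) and $Nil^*$ the upper nilradical (the largest nil ideal). *)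

(* Defs.v *)
From mathcomp Require Import all_boot all_algebra.
From mathcomp Require Import boolp classical_sets.

Set Implicit Arguments.
Unset Strict Implicit.
Unset Printing Implicit Defensive.

Import GRing.Theory.

Local Open Scope ring_scope.
Local Open Scope classical_set_scope.

(* The notions below are relative to a subring S of T, itself viewed as a ring:
   for instance [ideal S I] says that I is a two-sided ideal of S.  Taking
   S := [set: T] gives the notions for T. *)

Definition subring (T : pzRingType) (S : set T) : Prop :=
  GRing.subring_closed [in S].

Definition maximal_subring (T : pzRingType) (R : set T) : Prop :=
  [/\ subring R, R != [set: T] &
      forall S : set T, subring S -> R `<=` S -> S = R \/ S = [set: T]].

Definition ideal (T : pzRingType) (S I : set T) : Prop :=
  [/\ I `<=` S, GRing.zmod_closed [in I],
      (forall s x, S s -> I x -> I (s * x)) &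
      (forall x s, I x -> S s -> I (x * s))].

(* Since P is closed under sums, containing the pairwise products a * b is the
   same as containing the ideal product A B. *)
Definition prime_ideal (T : pzRingType) (S P : set T) : Prop :=
  [/\ ideal S P, P != S &
      forall A B : set T, ideal S A -> ideal S B ->
        (forall a b, A a -> B b -> P (a * b)) -> A `<=` P \/ B `<=` P].

Definition minimal_prime_ideal (T : pzRingType) (S P : set T) : Prop :=
  prime_ideal S P /\
  forall P' : set T, prime_ideal S P' -> P' `<=` P -> P' = P.

Definition nil_ideal (T : pzRingType) (S I : set T) : Prop :=
  ideal S I /\ forall x, I x -> exists n : nat, x ^+ n = 0.

(* The factor S only matters when S has no prime ideal (i.e. is zero): the
   empty intersection is then S, not T. *)
Definition lower_nilradical (T : pzRingType) (S : set T) : set T :=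
  S `&` \bigcap_(P in prime_ideal S) P.

(* For a subring S this union is itself a nil ideal: see
   [upper_nilradical_largest]. *)
Definition upper_nilradical (T : pzRingType) (S : set T) : set T :=
  \bigcup_(I in nil_ideal S) I.

Definition conductor (T : pzRingType) (R : set T) : set T :=
  [set x | forall t u : T, R (t * x * u)].

Lemma upper_nilradical_largest (T : pzRingType) (S : set T) : subring S ->
  nil_ideal S (upper_nilradical S) /\
  forall I, nil_ideal S I -> I `<=` upper_nilradical S.
Proof.
move=> [S1 SB SM]; split=> [|I nI x Ix]; last by exists I.
have {}S1 : S 1 by move: S1; rewrite inE.
have {}SB x y : S x -> S y -> S (x - y).
  by move=> Sx Sy; have := SB x y; rewrite !inE; apply.
have {}SM x y : S x -> S y -> S (x * y).
  by move=> Sx Sy; have := SM x y; rewrite !inE; apply.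
have SX x n : S x -> S (x ^+ n).
  by move=> Sx; elim: n => [|n IHn]; rewrite ?expr0 ?exprS //; apply: SM.
have idB I : ideal S I -> forall x y, I x -> I y -> I (x - y).
  by case=> _ [_ IB] _ _ x y Ix Iy; have := IB x y; rewrite !inE; apply.
have id0 I : ideal S I -> I 0 by case=> _ [+ _] _ _; rewrite inE.
have idN I : ideal S I -> forall x, I x -> I (- x).
  by move=> iI x Ix; rewrite -sub0r; apply: idB => //; apply: id0.
have idD I : ideal S I -> forall x y, I x -> I y -> I (x + y).
  by move=> iI x y Ix Iy; rewrite -[y]opprK; apply: idB => //; apply: idN.
have nil_sub I J x y : nil_ideal S I -> nil_ideal S J -> I x -> J y ->
    exists2 K, nil_ideal S K & K (x - y).
  move=> [iI nI] [iJ nJ] Ix Jy.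
  exists [set z | exists a b, [/\ I a, J b & z = a + b]]; last first.
    by exists x, (- y); split=> //; apply: idN.
  have [IS _ IMl IMr] := iI; have [JS _ JMl JMr] := iJ; split; first split.
  - move=> _ [a [b [Ia Jb ->]]]; rewrite -[b]opprK; apply: SB; first exact: IS.
    by apply: JS; apply: idN.
  - split.
      by rewrite inE; exists 0, 0; rewrite addr0; split=> //; exact: id0.
    move=> u v; rewrite !inE => -[a [b [Ia Jb ->]]] [c [d [Ic Jd ->]]].
    by exists (a - c), (b - d); rewrite opprD addrACA; split=> //; exact: idB.
  - move=> s _ Ss [a [b [Ia Jb ->]]]; exists (s * a), (s * b).
    by rewrite mulrDr; split=> //; [exact: IMl | exact: JMl].
  - move=> _ s [a [b [Ia Jb ->]]] Ss; exists (a * s), (b * s).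
    by rewrite mulrDl; split=> //; [exact: IMr | exact: JMr].
  move=> _ [a [b [Ia Jb ->]]]; have [n an0] := nI a Ia.
  have Sab : S (a + b)
    by rewrite -[b]opprK; apply: SB; [exact: IS | apply: JS; apply: idN].
  have Jm m : J ((a + b) ^+ m - a ^+ m).
    elim: m => [|m IHm]; first by rewrite !expr0 subrr; exact: id0.
    have -> : (a + b) ^+ m.+1 - a ^+ m.+1 =
        (a + b) * ((a + b) ^+ m - a ^+ m) + b * a ^+ m.
      by rewrite mulrBr (mulrDl a b (a ^+ m)) -!exprS opprD addrA subrK.
    by apply: idD => //; [exact: JMl | apply: JMr => //; apply: SX; apply: IS].
  have := Jm n; rewrite an0 subr0 => /nJ[k abk0].
  by exists (n * k)%N; rewrite exprM.
have n0 : nil_ideal S [set 0].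
  split; last by move=> _ ->; exists 1%N; rewrite expr1.
  split; first by move=> _ ->; rewrite -(subrr 1); apply: SB.
  - split; first by rewrite inE.
    by move=> x y; rewrite !inE => -> ->; rewrite /= subrr.
  - by move=> s _ _ ->; rewrite /= mulr0.
  - by move=> _ s -> _; rewrite /= mul0r.
split; last by move=> x [I [_ nI]]; apply: nI.
split.
- by move=> x [I [[IS _ _ _] _]] /IS.
- split; first by rewrite inE; exists [set 0].
  move=> x y; rewrite !inE => -[I nI Ix] [J nJ Jy].
  by have [K nK Kxy] := nil_sub _ _ _ _ nI nJ Ix Jy; exists K.
- by move=> s x Ss [I nI Ix]; exists I => //;
  case: nI => -[_ _ IMl _] _; apply: IMl.
- by move=> x s [I nI Ix] Ss; exists I => //;
  case: nI => -[_ _ _ IMr] _; apply: IMr.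
Qed.

(* Main.v *)
(** The engine is that [R + J] is [T] whenever [J] is closed under subtraction,
    multiplication and multiplication by [R], and is not contained in [R].
    If a prime [Q] of [T] is not contained in [R], then [R + Q = T], so that
    [R / (Q `&` R)] is isomorphic to the prime ring [T / Q]; hence either some
    prime of [T], and then a minimal one, lies in [R], or [Q `&` R] is prime in
    [R] for all primes [Q] of [T].  In the presence of a nonzero ideal [I] of
    [T] with [R `&` I = 0], primes [Q] of [T] inside [R] are prime in [R] as
    well: if [A B] lies in [Q], apply the principle to
    [J = {x in I | x B in Q}], which contains [I A].  Conversely [T = R + I], so
    every prime [P] of [R] is the trace of the prime [P + I] of [T]. *)

Require Import Defs.
From mathcomp Require Import all_boot all_algebra.
From mathcomp Require Import boolp classical_sets.

Set Implicit Arguments.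
Unset Strict Implicit.
Unset Printing Implicit Defensive.

Import GRing.Theory.

Local Open Scope ring_scope.
Local Open Scope classical_set_scope.

(** * Sums of subsets, and elementary facts on subrings and ideals *)

Definition set_add (T : pzRingType) (A B : set T) : set T :=
  [set a + b | a in A & b in B].

Section Closure.
Variable T : pzRingType.
Implicit Types (S I J A B P Q R : set T).

Lemma zmod_closed_setP S : GRing.zmod_closed [in S] <->
  S 0 /\ forall x y, S x -> S y -> S (x - y).
Proof.
split=> -[S0 SB]; split=> [|x y].
- by rewrite inE in S0.
- by have := SB x y; rewrite !inE.
- by rewrite inE.
- by rewrite !inE; apply: SB.
Qed.

Lemma subring_setP S : subring S <->
  [/\ S 1, forall x y, S x -> S y -> S (x - y) &
      forall x y, S x -> S y -> S (x * y)].
Proof.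
split=> -[S1 SB SM]; split=> [|x y|x y].
- by rewrite inE in S1.
- by have := SB x y; rewrite !inE.
- by have := SM x y; rewrite !inE.
- by rewrite inE.
- by rewrite !inE; apply: SB.
- by rewrite !inE; apply: SM.
Qed.

Lemma subring_setT : subring [set: T].
Proof. exact/subring_setP. Qed.

Lemma subring_zmod S : subring S -> GRing.zmod_closed [in S].
Proof.
move=> /subring_setP[S1 SB _]; apply/zmod_closed_setP; split=> //.
by rewrite -(subrr 1); apply: SB.
Qed.

Lemma zmod_closedD S x y : GRing.zmod_closed [in S] -> S x -> S y -> S (x + y).
Proof.
move=> /zmod_closed_setP[S0 SB] Sx Sy.
by rewrite -[y]opprK; apply: (SB) => //; rewrite -sub0r; apply: SB.
Qed.

Lemma zmod_closed_set_add A B : GRing.zmod_closed [in A] ->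
  GRing.zmod_closed [in B] -> GRing.zmod_closed [in set_add A B].
Proof.
move=> /zmod_closed_setP[A0 AB] /zmod_closed_setP[B0 BB].
apply/zmod_closed_setP; split; first by exists 0 => //; exists 0; rewrite ?addr0.
move=> _ _ [a Aa [b Bb <-]] [c Ac [d Bd <-]].
exists (a - c); first exact: AB.
by exists (b - d); [exact: BB | rewrite opprD addrACA].
Qed.

Lemma ideal_zmod S I : ideal S I -> GRing.zmod_closed [in I].
Proof. by case. Qed.

Lemma ideal0 S I : ideal S I -> I 0.
Proof. by case/ideal_zmod/zmod_closed_setP. Qed.

Lemma idealB S I x y : ideal S I -> I x -> I y -> I (x - y).
Proof. by move=> /ideal_zmod/zmod_closed_setP[_]; apply. Qed.

Lemma idealD S I x y : ideal S I -> I x -> I y -> I (x + y).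
Proof. by move=> /ideal_zmod; apply: zmod_closedD. Qed.

Lemma idealMl S I s x : ideal S I -> S s -> I x -> I (s * x).
Proof. by case=> _ _ IM _; apply: IM. Qed.

Lemma idealMr S I x s : ideal S I -> I x -> S s -> I (x * s).
Proof. by case=> _ _ _; apply. Qed.

Lemma sub_set_addl A I S : ideal S I -> A `<=` set_add A I.
Proof.
by move=> iI a Aa; exists a => //; exists 0; [exact: ideal0 iI | rewrite addr0].
Qed.

Lemma sub_set_addr I S B : ideal S I -> B `<=` set_add I B.
Proof.
by move=> iI b Bb; exists 0; [exact: ideal0 iI | exists b; rewrite ?add0r].
Qed.

Lemma ideal_eq S I : subring S -> ideal S I -> I 1 -> I = S.
Proof.
move=> sS iI I1; apply/seteqP; split=> [|s Ss]; first by case: iI.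
by rewrite -[s]mulr1; apply: idealMl iI _ _.
Qed.

Lemma prime_ideal_not1 S P : subring S -> prime_ideal S P -> ~ P 1.
Proof. by move=> sS [iP /eqP PS _] /(ideal_eq sS iP). Qed.

Lemma ideal_neq S I : subring S -> ~ I 1 -> I != S.
Proof. by move=> /subring_setP[S1 _ _] nI1; apply/eqP => IS; rewrite IS in nI1. Qed.

(** * Transfer of ideals between [R] and [T] by traces and sums *)

Lemma ideal_trace R I : subring R -> ideal [set: T] I -> ideal R (I `&` R).
Proof.
move=> sR iI; have /subring_setP[_ RB RM] := sR; split=> [x []//||s x Rs []|x s []].
- apply/zmod_closed_setP; split.
    by split; [exact: ideal0 iI | have /zmod_closed_setP[] := subring_zmod sR].
  by move=> x y [Ix Rx] [Iy Ry]; split; [exact: idealB iI _ _ | exact: RB].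
- by move=> Ix Rx; split; [exact: idealMl iI _ _ | exact: RM].
- by move=> Ix Rx Rs; split; [exact: idealMr iI _ _ | exact: RM].
Qed.

(** A multiplier [t] in [T] splits as [r + j] with [r] in [R] and [j] in [I]: in [(r + j)(a + i)]
    the term [r a] stays in [A], and everything else falls into [I]. *)
Lemma ideal_set_add R A I : ideal R A -> ideal [set: T] I ->
  set_add R I = [set: T] -> ideal [set: T] (set_add A I).
Proof.
move=> iA iI RI; split=> //.
- exact: zmod_closed_set_add (ideal_zmod iA) (ideal_zmod iI).
- move=> t _ _ [a Aa [i Ii <-]].
  have [r Rr [j Ij <-]] : set_add R I t by rewrite RI.
  exists (r * a); first exact: idealMl iA _ _.
  exists (j * a + (r + j) * i); last by rewrite mulrDr (mulrDl r j a) addrA.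
  by apply: (idealD iI); [exact: idealMr iI _ _ | exact: idealMl iI _ _].
- move=> _ t [a Aa [i Ii <-]] _.
  have [r Rr [j Ij <-]] : set_add R I t by rewrite RI.
  exists (a * r); first exact: idealMr iA _ _.
  exists (a * j + i * (r + j)); last by rewrite mulrDl (mulrDr a r j) addrA.
  by apply: (idealD iI); [exact: idealMl iI _ _ | exact: idealMr iI _ _].
Qed.

Lemma ideal_set_addT A I : ideal [set: T] A -> ideal [set: T] I ->
  ideal [set: T] (set_add A I).
Proof.
move=> iA iI; apply: (ideal_set_add iA iI); apply/seteqP; split=> // t _.
exact: sub_set_addl iI _ _.
Qed.

Lemma mul_set_add P A B I : ideal [set: T] I -> I `<=` P ->
  GRing.zmod_closed [in P] -> (forall a b, A a -> B b -> P (a * b)) ->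
  forall x y, set_add A I x -> set_add B I y -> P (x * y).
Proof.
move=> iI IP zP AB _ _ [a Aa [i Ii <-]] [b Bb [j Ij <-]].
rewrite mulrDr mulrDl -addrA; apply: zmod_closedD => //; first exact: AB.
apply/IP/(idealD iI); first exact: idealMr iI _ _.
exact: idealMl iI _ _.
Qed.

(** * The dichotomy for [R + J] when [R] is maximal *)

Lemma subring_set_add R J : subring R -> GRing.zmod_closed [in J] ->
  (forall r x, R r -> J x -> J (r * x)) ->
  (forall x r, J x -> R r -> J (x * r)) ->
  (forall x y, J x -> J y -> J (x * y)) ->
  subring (set_add R J).
Proof.
move=> sR zJ RJ JR JJ; have /subring_setP[R1 RB RM] := sR.
have [J0 _] := iffLR (zmod_closed_setP _) zJ.
apply/subring_setP; split.
- by exists 1 => //; exists 0; rewrite ?addr0.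
- have /zmod_closed_setP[_] := zmod_closed_set_add (subring_zmod sR) zJ.
  exact.
- move=> _ _ [a Ra [i Ji <-]] [b Rb [j Jj <-]].
  exists (a * b); first exact: RM.
  exists (i * b + (a * j + i * j)); last by rewrite mulrDr !mulrDl -!addrA.
  apply: zmod_closedD => //; first exact: JR.
  by apply: zmod_closedD => //; [exact: RJ | exact: JJ].
Qed.

(** [R + J] is a subring above [R], so maximality leaves two cases. The hypotheses allow a [J] that
    is no two-sided ideal of [T]: [prime_ideal_trace] uses a left ideal of [T] whose right stability
    is known only under [R]. *)
Lemma maximal_subring_set_add R J : maximal_subring R ->
  GRing.zmod_closed [in J] ->
  (forall r x, R r -> J x -> J (r * x)) ->
  (forall x r, J x -> R r -> J (x * r)) ->
  (forall x y, J x -> J y -> J (x * y)) ->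
  J `<=` R \/ set_add R J = [set: T].
Proof.
move=> [sR _ maxR] zJ RJ JR JJ.
have [J0 _] := iffLR (zmod_closed_setP _) zJ.
have [R0 _] := iffLR (zmod_closed_setP _) (subring_zmod sR).
have [|E|] := maxR _ (subring_set_add sR zJ RJ JR JJ); last by right.
- by move=> r Rr; exists r => //; exists 0; rewrite ?addr0.
- by left=> j Jj; rewrite -E; exists 0 => //; exists j; rewrite ?add0r.
Qed.

Lemma maximal_subring_set_add_ideal R I : maximal_subring R ->
  ideal [set: T] I -> I `<=` R \/ set_add R I = [set: T].
Proof.
move=> maxR iI; apply: maximal_subring_set_add => //; first exact: ideal_zmod iI.
- by move=> r x _; apply: idealMl iI _.
- by move=> x r Ix _; apply: idealMr iI Ix _.
- by move=> x y _; apply: idealMl iI _.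
Qed.

Lemma ideal_sub_conductor R I : ideal [set: T] I -> I `<=` R ->
  I `<=` conductor R.
Proof.
move=> iI IR x Ix t u; apply: IR.
by apply: (idealMr iI) => //; apply: (idealMl iI).
Qed.

(** * Primes of [T] traced on [R], and primes of [R] lifted to [T] *)

(* The set of [x] with [I x] inside [Q] is an ideal of [T]. *)
Lemma prime_ideal_mulr Q I B : prime_ideal [set: T] Q -> ideal [set: T] I ->
  ~ I `<=` Q -> (forall i b, I i -> B b -> Q (i * b)) -> B `<=` Q.
Proof.
move=> [iQ _ pQ] iI nIQ IB.
pose K : set T := [set x | forall i, I i -> Q (i * x)].
have iK : ideal [set: T] K.
  split=> //.
  - apply/zmod_closed_setP; split=> [i _|x y Kx Ky i Ii].
      by rewrite mulr0; exact: ideal0 iQ.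
    by rewrite mulrBr; apply: (idealB iQ); [exact: Kx | exact: Ky].
  - move=> t x _ Kx i Ii; rewrite mulrA; apply: Kx.
    exact: idealMr iI Ii _.
  - move=> x t Kx _ i Ii; rewrite mulrA.
    by apply: (idealMr iQ) => //; exact: Kx.
have [//|KQ] := pQ I K iI iK (fun i x Ii Kx => Kx i Ii).
by move=> b Bb; apply: KQ => i Ii; apply: IB.
Qed.

(** Since [R + Q = T], ideals [A], [B] of [R] with product in [Q] extend to ideals [A + Q], [B + Q]
    of [T], whose product is still in [Q]. *)
Lemma prime_ideal_trace_add R Q : subring R -> prime_ideal [set: T] Q ->
  set_add R Q = [set: T] -> prime_ideal R (Q `&` R).
Proof.
move=> sR prQ RQ; have [iQ _ pQ] := prQ; split; first exact: ideal_trace.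
  by apply: ideal_neq => // -[/(prime_ideal_not1 subring_setT prQ)].
move=> A B iA iB AB.
have [AR _ _ _] := iA; have [BR _ _ _] := iB.
have AB' a b : A a -> B b -> Q (a * b) by move=> Aa /(AB a b Aa)[].
have [] := pQ _ _ (ideal_set_add iA iQ RQ) (ideal_set_add iB iQ RQ).
- exact: mul_set_add iQ _ (ideal_zmod iQ) AB'.
- move=> AQ; left=> a Aa; split; last exact: AR.
  exact/AQ/(sub_set_addl iQ).
- move=> BQ; right=> b Bb; split; last exact: BR.
  exact/BQ/(sub_set_addl iQ).
Qed.

Lemma prime_ideal_trace R I Q : maximal_subring R -> ideal [set: T] I ->
  I != [set 0] -> R `&` I = [set 0] ->
  prime_ideal [set: T] Q -> prime_ideal R (Q `&` R).
Proof.
move=> maxR iI I0 RI0 prQ; have [sR _ _] := maxR.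
have /subring_setP[_ RB _] := sR; have [iQ _ pQ] := prQ.
have RI x : R x -> I x -> x = 0 by move=> Rx Ix; rewrite -[x = 0]/([set 0] x) -RI0.
have [QR|] := maximal_subring_set_add_ideal maxR iQ; last exact: prime_ideal_trace_add.
(* Otherwise [I] would lie in [R], and so be [R ∩ I = 0]. *)
have nIQ : ~ I `<=` Q.
  move=> IQ; case/eqP: I0; rewrite -RI0; apply/esym/setIidPr.
  exact: subset_trans IQ QR.
split; first exact: ideal_trace.
  by apply: ideal_neq => // -[/(prime_ideal_not1 subring_setT prQ)].
move=> A B iA iB AB; have [AR _ _ _] := iA; have [BR _ _ _] := iB.
(* [J] is a left ideal of [T]; on the right it absorbs [R] because [R B] lies in [B]. *)
pose J : set T := [set x | I x /\ forall b, B b -> Q (x * b)].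
have JT t x : J x -> J (t * x).
  move=> [Ix xB]; split=> [|b Bb]; first exact: idealMl iI _ Ix.
  by rewrite -mulrA; apply: (idealMl iQ) => //; exact: xB.
have [||||JR|RJ] := @maximal_subring_set_add R J maxR.
- apply/zmod_closed_setP; split.
    split=> [|b _]; first exact: ideal0 iI.
    by rewrite mul0r; exact: ideal0 iQ.
  move=> x y [Ix xB] [Iy yB]; split=> [|b Bb]; first exact: idealB iI _ _.
  by rewrite mulrBl; apply: (idealB iQ); [exact: xB | exact: yB].
- by move=> r x _; apply: JT.
- move=> x r [Ix xB] Rr; split=> [|b Bb]; first exact: idealMr iI Ix _.
  by rewrite -mulrA; apply: xB; exact: idealMl iB _ _.
- by move=> x y _; apply: JT.
(* If [J] lies in [R], then [I A], contained in [J], lies in [R ∩ I = 0]; so [I A] lies in [Q], and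
   hence so does [A]. *)
- left=> a Aa; split; last exact: AR.
  apply: (prime_ideal_mulr prQ iI nIQ _ Aa) => i {Aa}a Ii Aa.
  have Iia : I (i * a) by exact: idealMr iI Ii _.
  rewrite (RI (i * a)) //; first exact: ideal0 iQ.
  apply: JR; split=> // b Bb; rewrite -mulrA.
  by apply: (idealMl iQ) => //; have [] := AB a b Aa Bb.
(* If [R + J = T], the [R]-component of an element of [I] lies in [R ∩ I = 0]; so [J] is all of [I],
   and [I B] lies in [Q]. *)
- right=> b Bb; split; last exact: BR.
  apply: (prime_ideal_mulr prQ iI nIQ _ Bb) => i {Bb}b Ii Bb.
  have [r Rr [j [Ij jB] rj]] : set_add R J i by rewrite RJ.
  have r0 : r = 0.
    by apply: RI => //; rewrite -(addrK j r) rj; apply: idealB iI Ii Ij.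
  by rewrite -rj r0 add0r; exact: jB.
Qed.

(** [T] is the direct sum of [R] and [I], so [R] is a copy of [T / I], and [P + I] is the preimage
    of [P] under the projection. *)
Lemma prime_ideal_set_add R I P : subring R -> ideal [set: T] I ->
  R `&` I = [set 0] -> set_add R I = [set: T] ->
  prime_ideal R P -> prime_ideal [set: T] (set_add P I) /\ set_add P I `&` R = P.
Proof.
move=> sR iI RI0 RIT prP; have [iP _ pP] := prP.
have /subring_setP[R1 RB RM] := sR; have [PR _ _ _] := iP.
have iPI := ideal_set_add iP iI RIT.
have PIR : set_add P I `&` R = P.
  apply/seteqP; split=> [_ [[p Pp [i Ii <-]] Rpi]|p Pp]; last first.
    by split; [exact: sub_set_addl iI _ Pp | exact: PR].
  have : (R `&` I) i.
    by split=> //; rewrite -(addKr p i) addrC; apply: RB => //; apply: PR.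
  by rewrite RI0 => ->; rewrite addr0.
split=> //; split=> //.
  apply: ideal_neq => [|PI1]; first exact: subring_setT.
  by apply: (prime_ideal_not1 sR prP); rewrite -PIR.
move=> A B iA iB AB.
have trace C : ideal [set: T] C -> ideal R (set_add C I `&` R).
  by move=> iC; apply: ideal_trace => //; apply: ideal_set_addT.
(* The [R]-component [r = c - i] of [c] in [C] lies in the trace of [C + I], hence in [P]. *)
have lift C : ideal [set: T] C -> set_add C I `&` R `<=` P -> C `<=` set_add P I.
  move=> iC CP c Cc.
  have [r Rr [i Ii ri]] : set_add R I c by rewrite RIT.
  exists r; last by exists i.
  apply: CP; split=> //; exists c => //; exists (- i); last by rewrite -ri addrK.
  by rewrite -sub0r; apply: (idealB iI) => //; exact: ideal0 iI.
have [] := pP _ _ (trace A iA) (trace B iB).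
- move=> a b [ACa Ra] [BCb Rb]; rewrite -PIR; split; last exact: RM.
  apply: (mul_set_add iI _ (ideal_zmod iPI) AB ACa BCb).
  exact: sub_set_addr iP.
- by move/(lift A iA); left.
- by move/(lift B iB); right.
Qed.

(** * Chains of primes and minimal primes *)

Lemma prime_ideal_bigcap (I : Type) (D : set I) (F : I -> set T) S :
  D !=set0 -> subring S -> (forall i, D i -> prime_ideal S (F i)) ->
  (forall i j, D i -> D j -> F i `<=` F j \/ F j `<=` F i) ->
  prime_ideal S (\bigcap_(i in D) F i).
Proof.
move=> [i0 Di0] sS prF chainF.
have iF i : D i -> ideal S (F i) by move=> /prF[].
split.
- split=> [x Fx||s x Ss Fx i Di|x s Fx Ss i Di].
  + by have [FS _ _ _] := iF _ Di0; apply/FS/Fx.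
  + apply/zmod_closed_setP; split=> [i Di|x y Fx Fy i Di].
      exact: ideal0 (iF i Di).
    by apply: (idealB (iF i Di)); [exact: Fx | exact: Fy].
  + by apply: (idealMl (iF i Di)) => //; exact: Fx.
  + by apply: (idealMr (iF i Di)) => //; exact: Fx.
- by apply: ideal_neq => // /(_ _ Di0); apply: prime_ideal_not1 sS (prF _ Di0).
move=> A B iA iB AB; apply: contrapT => /not_orP[nA nB].
have not_sub C : ~ C `<=` \bigcap_(i in D) F i -> exists2 i, D i & ~ C `<=` F i.
  move=> nC; apply: contrapT => nE; apply: nC => c Cc i Di.
  by apply: contrapT => nFc; apply: nE; exists i => // /(_ c Cc).
have [i Di nAi] := not_sub _ nA; have [j Dj nBj] := not_sub _ nB.
(* The smaller of [F i] and [F j] contains neither [A] nor [B]. *)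
have [k [Dk nAk nBk]] : exists k, [/\ D k, ~ A `<=` F k & ~ B `<=` F k].
  have [Fij|Fji] := chainF i j Di Dj; [exists i|exists j]; split=> //.
    by move=> BF; apply/nBj/(subset_trans BF).
  by move=> AF; apply/nAi/(subset_trans AF).
by have [_ _ /(_ A B iA iB)[|//|//]] := prF k Dk => a b Aa Bb; exact: AB.
Qed.

Lemma exists_minimal_prime_ideal S Q : subring S -> prime_ideal S Q ->
  exists2 P, minimal_prime_ideal S P & P `<=` Q.
Proof.
move=> sS prQ.
(* [Zorn_bigcup] yields maximal sets, so it is applied to what is removed from [Q]: unions of the
   sets [X] become intersections of the primes [Q \ X]. *)
have [F FQ chainF|X [prX maxX]] := @Zorn_bigcup T [set X | prime_ideal S (Q `\` X)].
  (* Adding the empty set contributes [Q] itself to the intersection, which settles the empty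
     chain. *)
  pose G := F `|` [set set0].
  rewrite /= (_ : _ `\` _ = \bigcap_(X in G) (Q `\` X)); last first.
    apply/seteqP; split=> [x [Qx nFx] X GX|x Gx]; split=> //.
    - by move=> Xx; case: GX => [FX|X0]; [apply: nFx; exists X | rewrite X0 in Xx].
    - by have [] := Gx set0 (or_intror erefl).
    - by move=> [X FX Xx]; have [] := Gx X (or_introl FX).
  apply: prime_ideal_bigcap => //; first by exists set0; right.
  - by move=> X [/FQ//|->]; rewrite setD0.
  - move=> X Y [FX|->] [FY|->]; try by [left; apply: setDS | right; apply: setDS].
    by have [XY|YX] := chainF X Y FX FY; [right|left]; apply: setDS.
exists (Q `\` X); last by move=> x [].
split=> // P prP PQX; apply/seteqP; split=> // x [Qx nXx]; apply: contrapT => nPx.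
(* If [P] misses a point of [Q \ X], its complement strictly contains [X], while removing that
   complement from [Q] leaves the prime [P]. *)
apply: (maxX (~` P)).
  split=> [y Xy Py|]; first by have [] := PQX y Py.
  by move=> /(_ x nPx).
rewrite /= setDE setCK (_ : Q `&` P = P) //.
by apply/setIidPr => y /PQX[].
Qed.

(** * Nilpotency of the elements of the lower nilradical *)

Lemma ideal_bigcup (I : Type) (D : set I) (F : I -> set T) S :
  D !=set0 -> (forall i, D i -> ideal S (F i)) ->
  (forall i j, D i -> D j -> F i `<=` F j \/ F j `<=` F i) ->
  ideal S (\bigcup_(i in D) F i).
Proof.
move=> [i0 Di0] iF chainF; split.
- by move=> x [i /iF[FS _ _ _] /FS].
- apply/zmod_closed_setP; split=> [|x y [i Di Fx] [j Dj Fy]].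
    by exists i0 => //; exact: ideal0 (iF _ Di0).
  have [Fij|Fji] := chainF i j Di Dj; [exists j|exists i] => //.
    by apply: idealB (iF _ Dj) _ _ => //; exact: Fij.
  by apply: idealB (iF _ Di) _ _ => //; exact: Fji.
- by move=> s x Ss [i Di Fx]; exists i => //; exact: idealMl (iF _ Di) _ _.
- by move=> x s [i Di Fx] Ss; exists i => //; exact: idealMr (iF _ Di) _ _.
Qed.

Lemma ideal_set1_0 : ideal [set: T] [set 0].
Proof.
split=> //; first by apply/zmod_closed_setP; split=> // _ _ -> ->; rewrite /= subrr.
- by move=> t _ _ ->; rewrite /= mulr0.
- by move=> _ t -> _; rewrite /= mul0r.
Qed.

(* An ideal maximal among those that contain no power of [x] is prime. *)
Lemma lower_nilradical_nilpotent x : lower_nilradical [set: T] x ->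
  exists n : nat, x ^+ n = 0.
Proof.
move=> [_ Nx]; apply: contrapT => /forallNP nilx.
pose avoids I := ideal [set: T] I /\ forall n, ~ I (x ^+ n).
(* Adjoining [0] accounts for the empty chain, whose union is not an ideal. *)
have [F Fav chainF|X [[iP Px] maxX]] :=
    @Zorn_bigcup T [set X | avoids (X `|` [set 0])].
  pose G := F `|` [set set0].
  rewrite /= (_ : _ `|` _ = \bigcup_(X in G) (X `|` [set 0])); last first.
    apply/seteqP; split=> [y [[X FX Xy]|y0]|y [X GX [Xy|y0]]].
    - by exists X; left.
    - by exists set0; right.
    - by case: GX => [FX|X0]; [left; exists X | rewrite X0 in Xy].
    - by right.
  split.
    apply: ideal_bigcup; first by exists set0; right.
    - by move=> X [/Fav[]//|->]; rewrite set0U; exact: ideal_set1_0.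
    - move=> X Y [FX|->] [FY|->]; rewrite ?set0U; try by [left | right].
      by have [XY|YX] := chainF X Y FX FY; [left|right]; apply: setSU.
  move=> n [X [/Fav[_ /(_ n)]//|->]]; rewrite set0U; exact: nilx.
set P := X `|` [set 0] in iP Px.
(* By maximality of [P], the strictly larger ideal [A + P] must contain a power of [x]. *)
have big A : ideal [set: T] A -> ~ A `<=` P -> exists n, set_add A P (x ^+ n).
  move=> iA nAP; have iAP := ideal_set_addT iA iP.
  apply: contrapT => /forallNP nAPx; apply: (maxX (set_add A P)).
    split=> [y Xy|APX]; first by apply: (sub_set_addr iA); left.
    by apply: nAP => a Aa; left; apply: APX; exact: sub_set_addl iP _ _.
  rewrite /= setUidl // => _ ->; exact: ideal0 iAP.
suff prP : prime_ideal [set: T] P by apply: (Px 1%N); rewrite expr1; exact: Nx.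
split=> //.
  (* The exponent 0 counts among the avoided powers, which makes [P] proper. *)
  by apply: ideal_neq => [|P1]; [exact: subring_setT | apply: (Px 0%N); rewrite expr0].
move=> A B iA iB AB; apply: contrapT => /not_orP[/(big A iA)[m Am] /(big B iB)[n Bn]].
apply: (Px (m + n)%N); rewrite exprD.
exact: mul_set_add iP _ (ideal_zmod iP) AB _ _ Am Bn.
Qed.

(** This places the trace inside the upper nilradical of [R], the largest nil ideal. *)
Lemma nil_ideal_lower_nilradical_trace R : subring R ->
  nil_ideal R (lower_nilradical [set: T] `&` R).
Proof.
move=> sR; split; last by move=> x [/lower_nilradical_nilpotent].
apply: ideal_trace => //; split=> //.
- apply/zmod_closed_setP; split.
    by split=> // P [iP _ _]; exact: ideal0 iP.
  move=> x y [_ Nx] [_ Ny]; split=> // P prP; have [iP _ _] := prP.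
  by apply: (idealB iP); [exact: Nx | exact: Ny].
- move=> t x _ [_ Nx]; split=> // P prP; have [iP _ _] := prP.
  by apply: (idealMl iP) => //; exact: Nx.
- move=> x t [_ Nx] _; split=> // P prP; have [iP _ _] := prP.
  by apply: (idealMr iP) => //; exact: Nx.
Qed.

Lemma lower_nilradical_sub R :
  (forall Q, prime_ideal [set: T] Q -> prime_ideal R (Q `&` R)) ->
  lower_nilradical R `<=` lower_nilradical [set: T] `&` R.
Proof.
move=> prR x [Rx Nx]; split=> //; split=> // Q /prR prQR.
by have [] := Nx _ prQR.
Qed.

End Closure.

(** * The two alternatives, and equality when [R] meets a nonzero ideal trivially *)

Theorem theorem3p11 (T : pzRingType) (R : set T) (maxR : maximal_subring R) :
  ((exists Q : set T,
      [/\ minimal_prime_ideal [set: T] Q,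
          lower_nilradical [set: T] `<=` Q &
          Q `<=` conductor R])
   \/
   (lower_nilradical R `<=` lower_nilradical [set: T] `&` R /\
    lower_nilradical [set: T] `&` R `<=` upper_nilradical R))
  /\
  ((exists I : set T,
      [/\ ideal [set: T] I, I != [set 0] & R `&` I = [set 0]]) ->
   lower_nilradical R = lower_nilradical [set: T] `&` R).
Proof.
have [sR _ _] := maxR; split.
  (* The alternatives are separated by whether some prime of [T] lies in [R]. *)
  have [[Q prQ QR]|noQ] := pselect (exists2 Q, prime_ideal [set: T] Q & Q `<=` R).
    left; have [P minP PQ] := exists_minimal_prime_ideal (subring_setT T) prQ.
    have [prP _] := minP; have [iP _ _] := prP.
    exists P; split=> //; first by move=> x [_ /(_ P prP)].
    exact: ideal_sub_conductor iP (subset_trans PQ QR).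
  right; split.
    apply: lower_nilradical_sub => Q prQ; have [iQ _ _] := prQ.
    have [QR|] := maximal_subring_set_add_ideal maxR iQ.
      by case: noQ; exists Q.
    exact: prime_ideal_trace_add.
  have [_] := upper_nilradical_largest sR.
  by apply; exact: nil_ideal_lower_nilradical_trace.
move=> [I [iI I0 RI0]]; apply/seteqP; split.
  by apply: lower_nilradical_sub => Q; exact: prime_ideal_trace maxR iI I0 RI0.
have [IR|RIT] := maximal_subring_set_add_ideal maxR iI.
  by case/eqP: I0; rewrite -RI0; apply/esym/setIidPr.
(* An element of [R] lying in all primes of [T] lies in [P + I], whose trace on [R] is [P]. *)
move=> x [[_ Nx] Rx]; split=> // P prP.
have [prPI PIR] := prime_ideal_set_add sR iI RI0 RIT prP.
by rewrite -PIR; split=> //; exact: Nx.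
Qed.
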